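(* Assume in addition that $\rho(x,y)=0$ if and only if $x=y$. Let $X_1,X_2,\dots$ be i.i.d. with distribution $P$ (with joint law $\mathbb P=P^{\mathbb N}$). For any $D\geq0$ and any $\epsilon>0$ there exists a sequence of sets $C_n\subset A^n$, $n\ge1$, such that (i) $\frac1n\log M^n(C_n)\leq R(D)+\epsilon$ for all $n\geq1$; and (ii) $\mathbb P$-almost surely, $\rho_n(X_1^n,C_n)\leq D$ for all sufficiently large $n$.
   Context: Setting: $A$ is a finite set; $P$ is a probability mass function on $A$ with $P(a)>0$ for all $a\in A$; $\rho:A\times A\to[0,\infty)$; $M:A\to(0,\infty)$ is an arbitrary positive ''mass'' function. For $n\geq1$ and $x_1^n,y_1^n\in A^n$, $\rho_n(x_1^n,y_1^n)=\frac1n\sum_{i=1}^n\rho(x_i,y_i)$; $M^n(y_1^n)=\prod_{i=1}^n M(y_i)$ and $M^n(C)=\sum_{y_1^n\in C}M^n(y_1^n)$. For $C\subset A^n$, $\rho_n(x_1^n,C)=\min_{y_1^n\in C}\rho_n(x_1^n,y_1^n)$. Logarithms are natural. $H(\mu\|\nu)=\sum_s\mu(s)\log\frac{\mu(s)}{\nu(s)}$ is relative entropy. For a probability measure $Q$ on $A$ and $D\geq0$, ${\cal M}(P,Q,D)$ is the set of probability measures $W$ on $A\times A$ with first marginal $P$, second marginal $Q$, and $E_W[\rho(X,Y)]\leq D$; $I(P,Q,D)=\inf_{W\in{\cal M}(P,Q,D)}H(W\|P\times Q)$ ($+\infty$ if empty). $R(D)=R(D;P,M)=\inf_Q\{I(P,Q,D)+E_Q[\log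 M(Y)]\}$ over all probability distributions $Q$ on $A$. *)

(* Defs.v *)
From HB Require Import structures.
From mathcomp Require Import all_boot all_order all_algebra.
From mathcomp Require Import all_classical all_reals all_analysis.
Set Implicit Arguments. Unset Strict Implicit. Unset Printing Implicit Defensive.
Import Order.TTheory GRing.Theory Num.Theory.
Local Open Scope ring_scope.
Local Open Scope classical_set_scope.

Section Defs.
Variable R : realType.
Variable A : finType.

Definition is_pmf (Q : A -> R) : Prop := (forall a, 0 <= Q a) /\ \sum_a Q a = 1.

Definition relent (S : finType) (mu nu : S -> R) : R :=
  \sum_(s : S) (if mu s == 0 then 0 else mu s * ln (mu s / nu s)).

Definition prodm (P Q : A -> R) : A * A -> R := fun s => P s.1 * Q s.2.

Definition coupling_set (rho : A -> A -> R) (P Q : A -> R) (D : R) : set (A * A -> R) :=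
  [set W | (forall s, 0 <= W s) /\ (forall x, \sum_y W (x, y) = P x) /\
           (forall y, \sum_x W (x, y) = Q y) /\
           \sum_(s : A * A) W s * rho s.1 s.2 <= D].

(* I(P,Q,D) = inf over M(P,Q,D) of H(W || P x Q); +oo if empty *)
Definition Ifun (rho : A -> A -> R) (P Q : A -> R) (D : R) : \bar R :=
  ereal_inf [set (relent W (prodm P Q))%:E | W in coupling_set rho P Q D].

Definition Rfun (rho : A -> A -> R) (P M : A -> R) (D : R) : \bar R :=
  ereal_inf [set (Ifun rho P Q D + (\sum_y Q y * ln (M y))%:E)%E | Q in [set Q | is_pmf Q]].

Definition rhon (rho : A -> A -> R) (n : nat) (x y : {ffun 'I_n -> A}) : R :=
  n%:R^-1 * \sum_(i < n) rho (x i) (y i).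

Definition rhonC (rho : A -> A -> R) (n : nat) (x : {ffun 'I_n -> A})
  (C : {set {ffun 'I_n -> A}}) : \bar R :=
  \big[Order.min/+oo%E]_(y in C) (rhon rho x y)%:E.

Definition Mn (M : A -> R) (n : nat) (C : {set {ffun 'I_n -> A}}) : R :=
  \sum_(y in C) \prod_(i < n) M (y i).

Definition elog (x : R) : \bar R := if x == 0 then -oo%E else (ln x)%:E.

(* X_1^n(w) (indices shifted: X_1 is X 0) *)
Definition Xn (Omega : Type) (X : nat -> Omega -> A) (n : nat) (w : Omega)
  : {ffun 'I_n -> A} := [ffun i : 'I_n => X i w].

(* X_0, X_1, ... are i.i.d. with distribution P: every finite-dimensional
   law is the product law of P *)
Definition iid_with (d : measure_display) (Omega : measurableType d)
  (Pr : probability Omega R) (X : nat -> Omega -> A) (P : A -> R) : Prop :=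
  (forall i a, measurable (X i @^-1` [set a])) /\
  (forall (s : seq nat) (a : nat -> A), uniq s ->
     Pr (\bigcap_(i in [set` s]) (X i @^-1` [set a i])) = (\prod_(i <- s) P (a i))%:E).

End Defs.

(* Main.v *)
(** Fix a coupling [W] of [P] and [Q] whose cost [H(W || P x Q) + E_Q log M] is
    within [eps/2] of [R(D)]; after mixing in a little of the diagonal coupling,
    either its distortion is strictly below [D], or [D = 0] and the distortion
    vanishes [W]-almost surely. Weight the codeword [y] by
    [z(y) = prod_i Q(y_i) / M(y_i)], so that [sum_y z(y) M^n(y) = 1]. A Chernoff bound
    for [W^n] shows that, outside a set of exponentially small [P^n]-probability,
    every [x] satisfies
    [sum_(y | rho_n(x, y) <= D) z(y) >= exp (- n (R(D) + 3 eps / 4)) / 2]: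
    the multiple [2 exp (n (R(D) + 3 eps / 4)) z] is a fractional cover of the typical
    [x]. Weighted greedy covering turns it into a genuine codebook at the price of a
    factor linear in [n], and Borel-Cantelli gives the almost sure statement. For the
    finitely many [n] at which that factor is not yet absorbed the codebook is empty. *)
Require Import Defs.
From HB Require Import structures.
From mathcomp Require Import all_boot all_order all_algebra.
From mathcomp Require Import all_classical all_reals all_analysis.
From mathcomp Require Import ring lra.
Import Order.TTheory GRing.Theory Num.Theory.
Local Open Scope ring_scope.
Local Open Scope classical_set_scope.

(** * Exponential tail bound for product laws *)

Lemma expR_le_quadratic {R : realType} (u : R) :
  u <= 2^-1 -> expR u <= 1 + u + 2 * u ^+ 2.
Proof.
move=> hu.
have h1 : 1 - u <= expR (- u) := expR_ge1Dx (- u).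
have h2 : 0 < 1 - u by lra.
have h3 : 0 < expR u by exact: expR_gt0.
have h4 : expR u * expR (- u) = 1 by rewrite -expRD subrr expR0.
have h5 : expR u * (1 - u) <= 1.
  by rewrite -[leRHS]h4 ler_wpM2l // ltW.
(* Here [(1 - u) * (1 + u + 2 * u ^+ 2) = 1 + u ^+ 2 * (1 - 2 * u)], at least 1 for [u <= 2^-1]. *)
rewrite -(ler_pM2r h2); apply: le_trans h5 _; rewrite expr2; nra.
Qed.

Lemma ln_le_subr1 {R : realType} (v : R) : 0 < v -> ln v <= v - 1.
Proof.
move=> v0; have := @le_ln1Dx R (v - 1).
rewrite addrCA subrr addr0 => h; apply: h; lra.
Qed.

Lemma sum_prod_pairs {R : realType} {A B : finType} (n : nat) (f : A * B -> R) :
  \sum_(x : {ffun 'I_n -> A}) \sum_(y : {ffun 'I_n -> B}) \prod_(i < n) f (x i, y i)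
  = (\sum_s f s) ^+ n.
Proof.
under eq_bigr => x _ do rewrite -(bigA_distr_bigA (fun i b => f (x i, b))).
rewrite -(bigA_distr_bigA (fun _ a => \sum_b f (a, b))) prodr_const card_ord.
by rewrite pair_bigA /=; congr (_ ^+ _); apply: eq_bigr => -[].
Qed.

(** Exponential Markov inequality: [h - theta] has negative mean under [W], so for small [t > 0] its
    exponential moment [q] is below 1, and over [n] independent pairs this moment is [q ^+ n]. *)
Lemma chernoff {R : realType} {A B : finType} (W h : A * B -> R) (theta : R) :
  (forall s, 0 <= W s) -> \sum_s W s = 1 -> \sum_s W s * h s < theta ->
  exists2 q : R, 0 <= q < 1 & forall n : nat,
    \sum_(x : {ffun 'I_n -> A})
      \sum_(y : {ffun 'I_n -> B} | n%:R * theta < \sum_(i < n) h (x i, y i))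
        \prod_(i < n) W (x i, y i) <= q ^+ n.
Proof.
move=> W0 W1 hW.
set d := theta - \sum_s W s * h s.
have d0 : 0 < d by rewrite /d; lra.
pose K : R := 1 + \sum_s (h s - theta) ^+ 2.
have hK s : 1 + (h s - theta) ^+ 2 <= K.
  rewrite lerD2l (bigD1 s) //= lerDl; apply: sumr_ge0 => i _; exact: sqr_ge0.
have K0 : 0 < K by rewrite ltr_wpDr // sumr_ge0 // => i _; exact: sqr_ge0.
(* [2 * t * K < 1] will give [t * u <= 2^-1], and [2 * t * K < d] keeps the quadratic remainder
   below the linear gain [t * d]; the value [d / (d + 1)] meets both. *)
pose t := d / (d + 1) / (2 * K).
have t0 : 0 < t by rewrite !divr_gt0 //; lra.
have tK : 2 * t * K = d / (d + 1) by rewrite /t; field; apply/andP; split; lra.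
have tK1 : 2 * t * K < 1 by rewrite tK ltr_pdivrMr; lra.
have tKd : 2 * t * K < d.
  rewrite tK ltr_pdivrMr; last by lra.
  by rewrite mulrDr mulr1 ltrDr mulr_gt0.
pose q := \sum_s W s * expR (t * (h s - theta)).
exists q.
  apply/andP; split.
    by apply: sumr_ge0 => s _; rewrite mulr_ge0 ?expR_ge0.
  have : q <= \sum_s (W s + t * (W s * h s) - t * theta * W s + 2 * t ^+ 2 * K * W s).
    apply: ler_sum => s _; have := hK s; set u := h s - theta => hu.
    have tu : t * u <= 2^-1 by nra.
    have := expR_le_quadratic (t * u) tu => hexp.
    have hq : 2 * (t * u) ^+ 2 <= 2 * t ^+ 2 * K.
      rewrite exprMn mulrA; apply: ler_wpM2l; last by lra.
      by rewrite mulr_ge0 // exprn_ge0 // ltW.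
    have -> : W s + t * (W s * h s) - t * theta * W s + 2 * t ^+ 2 * K * W s
              = W s * (1 + t * u + 2 * t ^+ 2 * K) by rewrite /u; ring.
    by apply: ler_wpM2l => //; lra.
  rewrite !big_split /= sumrN -!mulr_sumr W1 !mulr1 => /le_lt_trans; apply.
  have -> : 1 + t * (\sum_s W s * h s) - t * theta + 2 * t ^+ 2 * K
          = 1 - t * (d - 2 * t * K) by rewrite /d; ring.
  have : 0 < t * (d - 2 * t * K) by rewrite mulr_gt0 //; lra.
  lra.
move=> n; rewrite -(sum_prod_pairs n (fun s => W s * expR (t * (h s - theta)))).
apply: ler_sum => x _; rewrite big_mkcond; apply: ler_sum => y _.
case: ifP => [hy|_]; last by apply: prodr_ge0 => i _; rewrite mulr_ge0 ?expR_ge0.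
rewrite big_split /= -expR_sum ler_peMr ?prodr_ge0 //.
rewrite -expR0 ler_expR -mulr_sumr mulr_ge0 ?(ltW t0) //.
rewrite sumrB sumr_const card_ord -mulr_natl; lra.
Qed.

(** * Weighted greedy covering *)

(* Greedy choice: some [y] buys its newly covered points at unit price at most
   [1 / (p * #|T|)], and the harmonic sum of these prices is at most [1 + ln #|T|]. *)
Lemma weighted_cover {R : realType} {X Y : finType} (N : X -> Y -> bool)
    (z m : Y -> R) (p : R) (T : {set X}) :
  (forall y, 0 <= z y) -> (forall y, 0 < m y) -> \sum_y z y * m y = 1 -> 0 < p ->
  (forall x, x \in T -> p <= \sum_(y | N x y) z y) ->
  exists2 C : {set Y}, forall x, x \in T -> exists2 y, y \in C & N x y &
    \sum_(y in C) m y <= if T == finset.set0 then 0 else p^-1 * (1 + ln #|T|%:R).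
Proof.
move=> z0 m0 zm p0.
have [k] := ubnP #|T|; elim: k T => // k IH T.
have [-> _ _|Tn0 cT hT] := eqVneq T finset.set0.
  exists finset.set0; first by move=> x; rewrite finset.in_set0.
  by rewrite big_set0.
have u0 : 0 < #|T|%:R :> R by rewrite ltr0n card_gt0.
pose S y := [set x in T | N x y].
(* Averaging: otherwise [zm] makes [\sum_y z y * #|S y|] smaller than [p * #|T|], whereas double
   counting and [hT] make it at least that. *)
have [y hy] : exists y, p * #|T|%:R * m y <= #|S y|%:R.
  apply: contrapT => /forallNP hn.
  have hlt y : #|S y|%:R < p * #|T|%:R * m y by rewrite ltNge; apply/negP/hn.
  have : \sum_y z y * #|S y|%:R < p * #|T|%:R.
    have <- : \sum_y z y * (p * #|T|%:R * m y) = p * #|T|%:R.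
      rewrite -[RHS]mulr1 -zm mulr_sumr; apply: eq_bigr => y _; ring.
    have [y zy] : exists y, 0 < z y.
      apply: contrapT => /forallNP hz; move: zm; rewrite big1 => [/eqP|y _].
        by rewrite eq_sym oner_eq0.
      have /negP := hz y; rewrite -leNgt => hz'.
      by have -> : z y = 0 by [apply/eqP; rewrite eq_le hz' z0]; rewrite mul0r.
    rewrite (bigD1 y) //= [ltRHS](bigD1 y) //=; apply: ltr_leD.
      by rewrite ltr_pM2l.
    by apply: ler_sum => i _; rewrite ler_wpM2l // ltW.
  apply/negP; rewrite -leNgt.
  have -> : \sum_y z y * #|S y|%:R = \sum_(x in T) \sum_(y | N x y) z y.
    rewrite (exchange_big_dep predT) //=; apply: eq_bigr => y _.
    rewrite sumr_const -[RHS]mulr_natr; congr (_ * _%:R).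
    by apply: eq_card => x; rewrite !inE.
  by rewrite mulr_natr -sumr_const; apply: ler_sum.
have Sy0 : (0 < #|S y|)%N.
  by rewrite -(ltr0n R); apply: lt_le_trans hy; rewrite !mulr_gt0.
have ST : S y \subset T by apply/fintype.subsetP => x; rewrite inE => /andP[].
have cST := subset_leq_card ST.
have cD : #|T :\: S y|%:R = #|T|%:R - #|S y|%:R :> R.
  by rewrite cardsD (finset.setIidPr ST) natrB.
have [||C' hC' cC'] := IH (T :\: S y).
- apply: leq_trans (_ : #|T| <= k)%N; last by [].
  by rewrite cardsD (finset.setIidPr ST) ltn_subrL Sy0 (leq_trans Sy0 cST).
- by move=> x; rewrite inE => /andP[_]; exact: hT.
exists (y |: C').
  move=> x xT; have [xy|xy] := boolP (N x y).
    by exists y; rewrite // !inE eqxx.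
  have [|y' y'C xy'] := hC' x; first by rewrite !inE xT (negbTE xy).
  by exists y'; rewrite // !inE y'C orbT.
have hmy : m y <= p^-1 * (#|S y|%:R / #|T|%:R).
  rewrite mulrA ler_pdivlMr // ler_pdivlMl //; apply: le_trans hy.
  by rewrite [m y * _]mulrC mulrA.
apply: le_trans (_ : m y + \sum_(y in C') m y <= _).
  have [yC|yC] := boolP (y \in C').
    rewrite (_ : y |: C' = C') ?lerDr ?ltW //.
    by apply/finset.setUidPr; rewrite finset.sub1set.
  by rewrite big_setU1.
apply: le_trans (lerD hmy cC') _.
(* If nothing remains to be covered, [y] alone costs at most [p^-1]. Otherwise the fraction just
   covered is at most [ln #|T| - ln #|T :\: S y|], so the prices telescope. *)
case: eqVneq => [E0|En0].
  rewrite addr0 ler_pM2l ?invr_gt0 //.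
  move: cD; rewrite E0 cards0 => /eqP; rewrite eq_sym subr_eq0 => /eqP <-.
  by rewrite divff ?lt0r_neq0 // lerDl ln_ge0 // ler1n card_gt0.
rewrite -mulrDr ler_pM2l ?invr_gt0 // addrCA lerD2l.
have v0 : 0 < #|T :\: S y|%:R :> R by rewrite ltr0n card_gt0.
have := ln_le_subr1 (#|T :\: S y|%:R / #|T|%:R) (divr_gt0 v0 u0).
rewrite ln_div ?posrE // {2}cD mulrBl divff ?lt0r_neq0 //; lra.
Qed.

(** * Relative entropy: positivity and joint convexity *)

(** The function [w * ln (w / u)] is jointly convex and homogeneous of degree one, so it lies above
    its tangent plane along the ray [w = c * u]; this is [ln v <= v - 1] at [v = u * c / w]. *)
Lemma relent_term_tangent {R : realType} (w u c : R) :
  0 <= w -> 0 <= u -> (u = 0 -> w = 0) -> 0 < c ->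
  w * ln c + w - u * c <= (if w == 0 then 0 else w * ln (w / u)).
Proof.
move=> w0 u0 uw c0; case: eqVneq => [->|wn0].
  by rewrite mul0r !add0r oppr_le0 mulr_ge0 // ltW.
have wp : 0 < w by rewrite lt_neqAle eq_sym wn0.
have up : 0 < u.
  by rewrite lt_neqAle u0 andbT eq_sym; apply: contra_neq wn0.
have := ln_le_subr1 (u * c / w) (divr_gt0 (mulr_gt0 up c0) wp).
rewrite -(ler_pM2l wp) mulrBr mulr1 [w * (_ / w)]mulrC divfK //.
rewrite !ln_div ?posrE ?mulr_gt0 // lnM ?posrE // !mulrBr !mulrDr; lra.
Qed.

Lemma relent_ge0 {R : realType} {S : finType} (mu nu : S -> R) :
  (forall s, 0 <= mu s) -> (forall s, 0 <= nu s) -> (forall s, nu s = 0 -> mu s = 0) ->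
  \sum_s nu s <= \sum_s mu s -> 0 <= relent mu nu.
Proof.
move=> mu0 nu0 ac hs.
apply: le_trans (_ : \sum_s (mu s - nu s) <= _).
  by rewrite sumrB subr_ge0.
apply: ler_sum => s _.
have := relent_term_tangent (mu s) (nu s) 1 (mu0 s) (nu0 s) (ac s) ltr01.
by rewrite ln1 mulr0 add0r mulr1.
Qed.

(* Log-sum inequality, from the tangent bound of both terms at the common slope
   [c = (mixture of mu) / (mixture of nu)]. *)
Lemma relent_convex {R : realType} {S : finType} (mu nu mu' nu' : S -> R) (l : R) :
  0 <= l <= 1 ->
  (forall s, 0 <= mu s) -> (forall s, 0 <= nu s) -> (forall s, nu s = 0 -> mu s = 0) ->
  (forall s, 0 <= mu' s) -> (forall s, 0 <= nu' s) -> (forall s, nu' s = 0 -> mu' s = 0) ->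
  relent (fun s => (1 - l) * mu s + l * mu' s) (fun s => (1 - l) * nu s + l * nu' s)
  <= (1 - l) * relent mu nu + l * relent mu' nu'.
Proof.
move=> /andP[l0 l1] mu0 nu0 ac mu'0 nu'0 ac'.
have k0 : 0 <= 1 - l by lra.
rewrite /relent !mulr_sumr -big_split /=; apply: ler_sum => s _.
set w := (1 - l) * mu s + l * mu' s; set u := (1 - l) * nu s + l * nu' s.
have wa : 0 <= (1 - l) * mu s by rewrite mulr_ge0.
have wb : 0 <= l * mu' s by rewrite mulr_ge0.
have ua : 0 <= (1 - l) * nu s by rewrite mulr_ge0.
have ub : 0 <= l * nu' s by rewrite mulr_ge0.
case: (eqVneq w 0) => [w0|wn0].
  have a0 : (1 - l) * mu s = 0 by move: w0; rewrite /w; lra.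
  have b0 : l * mu' s = 0 by move: w0; rewrite /w; lra.
  apply: addr_ge0.
    by case: ifP => _; rewrite ?mulr0 // mulrA a0 mul0r.
  by case: ifP => _; rewrite ?mulr0 // mulrA b0 mul0r.
have u0 : 0 < u.
  rewrite lt_neqAle addr_ge0 // andbT eq_sym.
  apply: contra_neq wn0 => u0.
  have /eqP : (1 - l) * nu s = 0 by move: u0; rewrite /u; lra.
  have /eqP : l * nu' s = 0 by move: u0; rewrite /u; lra.
  rewrite !mulf_eq0 /w => /orP[/eqP ->|/eqP /ac' ->] /orP[/eqP ->|/eqP /ac ->];
    by rewrite ?(mul0r, mulr0, addr0).
have w0 : 0 < w by rewrite lt_neqAle eq_sym wn0 addr_ge0.
have c0 : 0 < w / u by rewrite divr_gt0.
have h1 := relent_term_tangent (mu s) (nu s) (w / u) (mu0 s) (nu0 s) (ac s) c0.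
have h2 := relent_term_tangent (mu' s) (nu' s) (w / u) (mu'0 s) (nu'0 s) (ac' s) c0.
apply: le_trans (lerD (ler_wpM2l k0 h1) (ler_wpM2l l0 h2)).
have huw : u * (w / u) = w by rewrite mulrC divfK // gt_eqF.
have -> : (1 - l) * (mu s * ln (w / u) + mu s - nu s * (w / u)) +
   l * (mu' s * ln (w / u) + mu' s - nu' s * (w / u))
   = w * ln (w / u) + w - u * (w / u) by rewrite /w /u; ring.
by rewrite huw addrK.
Qed.

(** * Couplings and near-minimisers for [Rfun] *)

Section Coupling.
Context {R : realType} {A : finType}.
Implicit Types (P Q : A -> R) (rho : A -> A -> R) (W : A * A -> R).

Lemma coupling_sum1 rho P Q D W : is_pmf P -> coupling_set rho P Q D W ->
  \sum_s W s = 1.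
Proof.
move=> [_ P1] [_ [hP _]]; rewrite -P1.
rewrite -(eq_bigr _ (fun x _ => hP x)) pair_bigA /=.
by apply: eq_bigr => -[].
Qed.

(** If [Q y = 0], the nonnegative column of [W] at [y] sums to zero, so on the support of [W] the
    ratio in [relent] has a positive denominator. *)
Lemma coupling_ac rho P Q D W : (forall a, 0 < P a) -> coupling_set rho P Q D W ->
  forall s, prodm P Q s = 0 -> W s = 0.
Proof.
move=> P0 [W0 [_ [hQ _]]] [x y] /eqP.
rewrite /prodm /= mulf_eq0 gt_eqF //= => /eqP Qy; apply/eqP.
rewrite eq_le W0 andbT -Qy -hQ (bigD1 x) //= lerDl.
by apply: sumr_ge0 => i _.
Qed.

Lemma prodm_ge0 P Q : is_pmf P -> is_pmf Q -> forall s, 0 <= prodm P Q s.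
Proof. by move=> [P0 _] [Q0 _] s; rewrite mulr_ge0. Qed.

Lemma prodm_sum1 P Q : is_pmf P -> is_pmf Q -> \sum_s prodm P Q s = 1.
Proof.
move=> [_ P1] [_ Q1]; rewrite -(pair_bigA _ (fun x y => P x * Q y)) /=.
by under eq_bigr => x _ do rewrite -mulr_sumr Q1 mulr1.
Qed.

Lemma relent_coupling_ge0 rho P Q D W : is_pmf P -> (forall a, 0 < P a) -> is_pmf Q ->
  coupling_set rho P Q D W -> 0 <= relent W (prodm P Q).
Proof.
move=> hP P0 hQ hW; apply: relent_ge0; first by case: hW.
- exact: prodm_ge0.
- exact: coupling_ac hW.
- by rewrite prodm_sum1 // (coupling_sum1 _ _ _ _ _ hP hW).
Qed.

(** The law of [(X, X)] for [X] of law [P]. *)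
Definition diag P : A * A -> R := fun s => if s.1 == s.2 then P s.1 else 0.

Lemma sum_diag P (f : A * A -> R) : \sum_s diag P s * f s = \sum_a P a * f (a, a).
Proof.
transitivity (\sum_x \sum_y diag P (x, y) * f (x, y)).
  by rewrite pair_bigA /=; apply: eq_bigr => -[].
apply: eq_bigr => x _; rewrite (bigD1 x) //= /diag eqxx big1 ?addr0 // => y yx.
by rewrite /= eq_sym (negbTE yx) mul0r.
Qed.

Lemma diag_coupling rho P D : is_pmf P -> (forall x, rho x x = 0) -> 0 <= D ->
  coupling_set rho P P D (diag P).
Proof.
move=> [P0 _] rho0 D0; split=> [s|]; first by rewrite /diag; case: ifP.
split=> [x|].
  rewrite (bigD1 x) //= /diag eqxx big1 ?addr0 // => y yx.
  by rewrite /= eq_sym (negbTE yx).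
split=> [y|].
  rewrite (bigD1 y) //= /diag eqxx big1 ?addr0 // => x yx.
  by rewrite /= (negbTE yx).
by rewrite sum_diag big1 // => a _; rewrite rho0 mulr0.
Qed.

(** From below, couplings have nonnegative relative entropy and [Q y <= 1]; from above, [Q = P] with
    the diagonal coupling is feasible. Finiteness is what makes near-minimisers available. *)
Lemma Rfun_fin_num rho P (M : A -> R) D : is_pmf P -> (forall a, 0 < P a) ->
  (forall x, rho x x = 0) -> 0 <= D -> Rfun rho P M D \is a fin_num.
Proof.
move=> hP P0 rho0 D0; rewrite fin_real //; apply/andP; split.
  apply: lt_le_trans (_ : ((- \sum_y `|ln (M y)|)%:E <= _)%E); first exact: ltNyr.
  apply/ereal_infP => _ [Q [Q0 Q1] <-].
  rewrite -[leLHS]add0e; apply: leeD.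
    apply/ereal_infP => _ [W hW <-]; rewrite lee_fin.
    exact: relent_coupling_ge0 hW.
  rewrite lee_fin -sumrN; apply: ler_sum => y _.
  have Qy1 : Q y <= 1.
    by rewrite -Q1 (bigD1 y) //= lerDl; apply: sumr_ge0.
  apply: le_trans (_ : - (Q y * `|ln (M y)|) <= _).
    by rewrite lerN2 ler_piMl.
  by rewrite -mulrN ler_wpM2l // lerNl -normrN ler_norm.
apply: le_lt_trans (_ : (relent (diag P) (prodm P P) + \sum_y P y * ln (M y))%:E < _)%E;
  last exact: ltry.
apply: le_trans (ereal_inf_lbound _) _; first by exists P.
rewrite EFinD leeD2r //; apply: ereal_inf_lbound.
by exists (diag P) => //; exact: diag_coupling.
Qed.

(* Mixing a near-optimal coupling with the diagonal one makes the distortion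
   constraint strict when [D > 0]; when [D = 0] the distortion vanishes on the
   support of the coupling. *)
Lemma near_optimal_coupling rho P (M : A -> R) D eps :
  is_pmf P -> (forall a, 0 < P a) -> (forall x y, 0 <= rho x y) ->
  (forall x, rho x x = 0) -> 0 <= D -> 0 < eps ->
  exists Q W, [/\ is_pmf Q, coupling_set rho P Q D W,
    (\sum_s W s * rho s.1 s.2 < D) \/ (forall s, W s * rho s.1 s.2 = 0) &
    ((relent W (prodm P Q) + \sum_y Q y * ln (M y))%:E <= Rfun rho P M D + eps%:E)%E].
Proof.
move=> hP P0 rho0 rhoxx D0 eps0.
have Rfin := Rfun_fin_num rho P M D hP P0 rhoxx D0.
(* One half of [eps] pays for the choice of [Q] and [W], the other for the mixing. *)
have e0 : 0 < eps / 2 by rewrite divr_gt0.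
have [_ [Q hQ <-] hlt] := lb_ereal_inf_adherent e0 Rfin.
rewrite -/(Rfun rho P M D) -(fineK Rfin) -EFinD in hlt *.
set r := fine _ in hlt *.
have hI : (Ifun rho P Q D < (r + eps / 2 - \sum_y Q y * ln (M y))%:E)%E.
  by rewrite EFinB lteBrDr.
have [_ [W hW <-]] := ereal_inf_lt hI.
rewrite lte_fin => hWr.
have [W0 [WP [WQ WD]]] := hW.
have [Q0 Q1] := hQ.
have WD0 s : 0 <= W s * rho s.1 s.2 by rewrite mulr_ge0.
have [DE|Dn0] := eqVneq D 0.
  exists Q, W; split=> //; last by rewrite -EFinD lee_fin; lra.
  right=> s; apply/eqP; rewrite eq_le WD0 andbT.
  apply: le_trans (_ : \sum_s W s * rho s.1 s.2 <= _); last by rewrite -{2}DE.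
  by rewrite (bigD1 s) //= lerDl; apply: sumr_ge0 => i _.
have Dp : 0 < D by rewrite lt_neqAle eq_sym Dn0.
pose c0 := relent W (prodm P Q) + \sum_y Q y * ln (M y).
pose c1 := relent (diag P) (prodm P P) + \sum_y P y * ln (M y).
have hdiag := diag_coupling rho P D hP rhoxx D0.
have den0 : 0 < eps / 2 + `|c1 - c0| by rewrite ltr_wpDr.
(* Small enough for mixing to raise the cost by at most [eps / 2], whatever the sign of
   [c1 - c0]. *)
pose l := eps / 2 / (eps / 2 + `|c1 - c0|).
have l0 : 0 < l by rewrite divr_gt0.
have l1 : l <= 1 by rewrite ler_pdivrMr // mul1r lerDl.
have k0 : 0 <= 1 - l by lra.
have lc : l * (c1 - c0) <= eps / 2.
  apply: le_trans (_ : l * (eps / 2 + `|c1 - c0|) <= _).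
    by rewrite ler_pM2l // ler_wpDl ?ler_norm // ltW.
  by rewrite /l divfK ?gt_eqF.
pose Ql a := (1 - l) * Q a + l * P a.
pose Wl s := (1 - l) * W s + l * diag P s.
have [dP0 [dPP [dPQ _]]] := hdiag.
have [Pge0 P1] := hP.
have rhoWl : \sum_s Wl s * rho s.1 s.2 = (1 - l) * \sum_s W s * rho s.1 s.2.
  have d0 : \sum_s diag P s * rho s.1 s.2 = 0.
    by rewrite sum_diag big1 // => a _; rewrite rhoxx mulr0.
  transitivity ((1 - l) * (\sum_s W s * rho s.1 s.2)
    + l * \sum_s diag P s * rho s.1 s.2); last by rewrite d0 mulr0 addr0.
  by rewrite !mulr_sumr -big_split; apply: eq_bigr => s _; rewrite /Wl mulrDl !mulrA.
have rhoWlD : \sum_s Wl s * rho s.1 s.2 < D.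
  rewrite rhoWl; apply: le_lt_trans (ler_wpM2l k0 WD) _.
  by rewrite mulrBl mul1r ltrBlDr ltrDl mulr_gt0.
exists Ql, Wl; split.
- split; first by move=> a; rewrite addr_ge0 // mulr_ge0 // ltW.
  by rewrite big_split /= -!mulr_sumr Q1 P1 !mulr1 subrK.
- split; first by move=> s; rewrite addr_ge0 // mulr_ge0 // ltW.
  split; first by move=> x; rewrite big_split /= -!mulr_sumr WP dPP -mulrDl subrK mul1r.
  split; first by move=> x; rewrite big_split /= -!mulr_sumr WQ dPQ.
  exact: ltW.
- by left.
- rewrite -EFinD lee_fin.
  have -> : prodm P Ql = fun s => (1 - l) * prodm P Q s + l * prodm P P s.
    by apply/funext => s; rewrite /prodm /Ql; ring.
  have hl : 0 <= l <= 1 by rewrite ltW.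
  have := relent_convex _ _ _ _ l hl W0 (prodm_ge0 P Q hP hQ)
    (coupling_ac _ _ _ _ _ P0 hW) dP0 (prodm_ge0 P P hP hP) (coupling_ac _ _ _ _ _ P0 hdiag).
  rewrite -/Wl.
  have -> : \sum_y Ql y * ln (M y)
      = (1 - l) * (\sum_y Q y * ln (M y)) + l * \sum_y P y * ln (M y).
    by rewrite !mulr_sumr -big_split; apply: eq_bigr => y _ /=; rewrite /Ql; ring.
  have hc : c0 < r + eps / 2 by rewrite /c0; lra.
  have : (1 - l) * c0 + l * c1 <= r + eps by lra.
  by rewrite /c0 /c1; lra.
Qed.

End Coupling.

(** * Typical source sequences *)

(** A sequence [x] is typical when bad [y] carry at most half of [P^n(x)] under [W^n]. Markov's
    inequality bounds the atypical mass; a change of measure on the good pairs gives the lower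
    bound. *)
Lemma typical_sets {R : realType} {A : finType} (rho : A -> A -> R) (P Q M : A -> R)
    (W : A * A -> R) (D r : R) :
  is_pmf P -> (forall a, 0 < P a) -> is_pmf Q -> (forall a, 0 < M a) -> 0 <= D ->
  coupling_set rho P Q D W ->
  (\sum_s W s * rho s.1 s.2 < D) \/ (forall s, W s * rho s.1 s.2 = 0) ->
  relent W (prodm P Q) + \sum_y Q y * ln (M y) < r ->
  exists T : forall n : nat, {set {ffun 'I_n -> A}}, exists q : R,
  [/\ 0 < q < 1,
      forall n, \sum_(x | x \notin T n) \prod_(i < n) P (x i) <= 4 * q ^+ n &
      forall n x, x \in T n -> 2^-1 * expR (- (n%:R * r)) <=
        \sum_(y : {ffun 'I_n -> A} | \sum_(i < n) rho (x i) (y i) <= n%:R * D)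
           \prod_(i < n) (Q (y i) / M (y i))].
Proof.
move=> hP P0 [Q0 Q1] M0 D0 hW hD hr.
have [W0 [WP [WQ WD]]] := hW.
have W1 := coupling_sum1 _ _ _ _ _ hP hW.
have ac := coupling_ac _ _ _ _ _ P0 hW.
(* The mean of [g] under [W] is the cost; the value 0 off the support of [W] does not affect it. *)
pose g s := if W s == 0 then 0 else ln (W s / prodm P Q s) + ln (M s.2).
have hg : \sum_s W s * g s < r.
  suff -> : \sum_s W s * g s = relent W (prodm P Q) + \sum_y Q y * ln (M y) by [].
  have -> : \sum_y Q y * ln (M y) = \sum_s W s * ln (M s.2).
    transitivity (\sum_x \sum_y W (x, y) * ln (M y)).
      rewrite exchange_big /=; apply: eq_bigr => y _.
      by rewrite -WQ mulr_suml.
    by rewrite pair_bigA /=; apply: eq_bigr => -[].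
  rewrite -big_split; apply: eq_bigr => s _ /=; rewrite /g.
  by case: eqVneq => [->|_]; rewrite ?mul0r ?addr0 // mulrDr.
have Wn0 n (x y : {ffun 'I_n -> A}) : 0 <= \prod_(i < n) W (x i, y i).
  by apply: prodr_ge0.
have [q1 /andP[q10 q11] hq1] := chernoff W g r W0 W1 hg.
have [q2 /andP[q20 q21] hq2] : exists2 q : R, 0 <= q < 1 & forall n : nat,
    \sum_(x : {ffun 'I_n -> A})
      \sum_(y : {ffun 'I_n -> A} | n%:R * D < \sum_(i < n) rho (x i) (y i))
        \prod_(i < n) W (x i, y i) <= q ^+ n.
  case: hD => [hD|hD]; first exact: (chernoff W (fun s => rho s.1 s.2) D W0 W1 hD).
  (* Zero distortion on the support: every pair exceeding [n * D] has [W^n]-mass 0. *)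
  exists 0; first by rewrite lexx ltr01.
  move=> n; rewrite big1 ?exprn_ge0 // => x _; rewrite big1 // => y.
  rewrite ltNge => /negP hxy; apply: contrapT => /eqP hne; apply: hxy.
  rewrite big1 ?mulr_ge0 // => i _.
  have := hD (x i, y i) => /eqP; rewrite mulf_eq0 => /orP[/eqP Wi|/eqP //].
  by move: hne; rewrite (bigD1 i) //= Wi mul0r eqxx.
pose bad n (x y : {ffun 'I_n -> A}) := (n%:R * r < \sum_(i < n) g (x i, y i)) ||
  (n%:R * D < \sum_(i < n) rho (x i) (y i)).
(* The floor [2^-1] keeps [q] positive even if both rates vanish. *)
pose q := Num.max 2^-1 (Num.max q1 q2).
have hbad n : \sum_x \sum_(y | bad n x y) \prod_(i < n) W (x i, y i) <= 2 * q ^+ n.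
  rewrite mulr2n mulrDl mul1r.
  apply: le_trans (_ : q1 ^+ n + q2 ^+ n <= _); last first.
    by apply: lerD; apply: lerXn2r; rewrite ?nnegrE ?le_max ?q10 ?q20 ?lexx ?orbT.
  apply: le_trans (lerD (hq1 n) (hq2 n)); rewrite -big_split; apply: ler_sum => x _ /=.
  rewrite [leLHS]big_mkcond [X in _ <= X + _]big_mkcond [X in _ <= _ + X]big_mkcond.
  rewrite -big_split; apply: ler_sum => y _ /=; rewrite /bad.
  by case: (n%:R * r < _); case: (n%:R * D < _) => /=; rewrite ?addr0 ?add0r ?lerDl ?Wn0.
exists (fun n => [set x : {ffun 'I_n -> A} |
  2 * \sum_(y | bad n x y) \prod_(i < n) W (x i, y i) <= \prod_(i < n) P (x i)]%SET).
exists q; split.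
- by rewrite lt_max invr_gt0 ltr0n /= !gt_max q11 q21 invf_lt1 ?ltr1n.
- move=> n; apply: le_trans (_ : 2 * (2 * q ^+ n) <= _); last by rewrite mulrA -natrM.
  apply: le_trans (ler_wpM2l _ (hbad n)) => //.
  rewrite mulr_sumr [leRHS](bigID (fun x => x \notin
    [set x : {ffun 'I_n -> A} | 2 * \sum_(y | bad n x y) \prod_(i < n) W (x i, y i)
      <= \prod_(i < n) P (x i)]%SET)) /=.
  apply: le_trans (_ : _ <= _ + 0) (lerD (lexx _) _); last first.
    apply: sumr_ge0 => x _; rewrite mulr_ge0 //; apply: sumr_ge0 => y _; exact: Wn0.
  rewrite addr0; apply: ler_sum => x; rewrite inE -ltNge => /ltW; exact.
- move=> n x; rewrite inE => hx.
  have hPx : \prod_(i < n) P (x i) = \sum_(y : {ffun 'I_n -> A}) \prod_(i < n) W (x i, y i).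
    rewrite -(bigA_distr_bigA (fun i b => W (x i, b))); apply: eq_bigr => i _.
    by rewrite WP.
  have Pn0 : 0 < \prod_(i < n) P (x i) by apply: prodr_gt0.
  have z0 (y : {ffun 'I_n -> A}) : 0 <= \prod_(i < n) (Q (y i) / M (y i)).
    by apply: prodr_ge0 => i _; rewrite divr_ge0 // ltW.
  (* On a good pair of positive mass, [W^n] equals [P^n] times [exp (\sum g)] times the weight of
     [y], and [\sum g <= n * r]. *)
  have key (y : {ffun 'I_n -> A}) : ~~ bad n x y -> \prod_(i < n) W (x i, y i) <=
      \prod_(i < n) P (x i) * expR (n%:R * r) * \prod_(i < n) (Q (y i) / M (y i)).
    rewrite negb_or -!leNgt => /andP[hgy _].
    have rhs0 : 0 <= \prod_(i < n) P (x i) * expR (n%:R * r)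
        * \prod_(i < n) (Q (y i) / M (y i)) by rewrite !mulr_ge0 ?expR_ge0 ?(ltW Pn0).
    case: (eqVneq (\prod_(i < n) W (x i, y i)) 0) => [-> //|/prodf_neq0 hne].
    have -> : \prod_(i < n) W (x i, y i) = \prod_(i < n) P (x i) *
        expR (\sum_(i < n) g (x i, y i)) * \prod_(i < n) (Q (y i) / M (y i)).
      rewrite expR_sum -!big_split; apply: eq_bigr => i _ /=.
      have Wi := hne i isT; rewrite /g (negbTE Wi) /prodm /=.
      have Qi : 0 < Q (y i).
        rewrite lt_neqAle Q0 andbT eq_sym; apply: contra_neq Wi => Qi.
        by apply: ac; rewrite /prodm Qi mulr0.
      have Wi0 : 0 < W (x i, y i) by rewrite lt_neqAle eq_sym Wi W0.
      have := P0 (x i); have := M0 (y i) => Mi Pi.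
      rewrite expRD !lnK ?posrE // ?divr_gt0 ?mulr_gt0 //.
      by field; rewrite !gt_eqF.
    by rewrite ler_wpM2r // ler_wpM2l ?ler_expR // ltW.
  (* Good [y] carry at least half of [P^n(x)], whence the factor [2^-1] in the conclusion. *)
  have : \prod_(i < n) P (x i) <= 2 * \sum_(y | ~~ bad n x y) \prod_(i < n) W (x i, y i).
    have : \prod_(i < n) P (x i) = \sum_(y | bad n x y) \prod_(i < n) W (x i, y i)
        + \sum_(y | ~~ bad n x y) \prod_(i < n) W (x i, y i).
      by rewrite hPx (bigID (bad n x)).
    move: hx; lra.
  set S := \sum_(y | ~~ _) _ => h2.
  pose Z := \sum_(y | ~~ bad n x y) \prod_(i < n) (Q (y i) / M (y i)).
  have h1 : S <= \prod_(i < n) P (x i) * expR (n%:R * r) * Z.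
    by rewrite mulr_sumr; apply: ler_sum.
  apply: le_trans (_ : Z <= _); last first.
    rewrite /Z [leLHS]big_mkcond [leRHS]big_mkcond; apply: ler_sum => y _.
    rewrite /bad negb_or -!leNgt; case: (_ <= n%:R * D); rewrite ?andbT ?andbF //.
    by case: ifP.
  have E0 := expR_gt0 (n%:R * r).
  rewrite expRN -(ler_pM2l (mulr_gt0 Pn0 E0)); move: E0 h1 h2.
  set p := \prod_(i < n) P (x i); set E := expR _ => E0 h1 h2.
  have -> : p * E * (2^-1 * E^-1) = p / 2 by field; rewrite gt_eqF.
  lra.
Qed.

(** * From fractional cover to codebook *)

(** With [a = n * (delta / 2)], the exponential is at least [a ^+ 2], which is quadratic in [n] and
    overtakes the linear left side. *)
Lemma polynomial_le_expR {R : realType} (L delta : R) : 0 <= L -> 0 < delta ->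
  exists N : nat, forall n : nat, (N <= n)%N ->
    2 * (1 + n%:R * L) <= expR (n%:R * delta).
Proof.
move=> L0 d0.
have [N hN] : exists N : nat, (2 * L + 2) / (delta / 2) ^+ 2 < N%:R.
  by eexists; exact: truncnS_gt.
exists N.+1 => n Nn.
have e0 : 0 < (delta / 2) ^+ 2 by rewrite exprn_gt0 // divr_gt0.
have n1 : 1 <= n%:R :> R by rewrite ler1n; exact: leq_trans Nn.
have hn : 2 * L + 2 <= n%:R * (delta / 2) ^+ 2.
  by rewrite -ler_pdivrMr //; apply: le_trans (ltW hN) _; rewrite ler_nat ltnW.
have : 1 + n%:R * (delta / 2) <= expR (n%:R * (delta / 2)) by exact: expR_ge1Dx.
have -> : expR (n%:R * delta) = expR (n%:R * (delta / 2)) * expR (n%:R * (delta / 2)).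
  by rewrite -expRD; congr expR; field.
have a0 : 0 < n%:R * (delta / 2) by rewrite mulr_gt0 ?divr_gt0 // (lt_le_trans ltr01).
set E := expR _; set a := n%:R * _ in a0 * => hE.
have haa : n%:R * (2 * L + 2) <= a * a.
  have -> : a * a = n%:R * (n%:R * (delta / 2) ^+ 2) by rewrite /a; ring.
  by rewrite ler_wpM2l // (le_trans ler01).
have : a * a <= E * E by apply: ler_pM; lra.
lra.
Qed.

Lemma pmf_card_gt0 {R : realType} {A : finType} (Q : A -> R) :
  is_pmf Q -> (0 < #|A|)%N.
Proof.
move=> [_ Q1]; rewrite lt0n; apply/negP => /eqP /card0_eq hA.
move: Q1; rewrite big_pred0 => [/eqP|a]; first by rewrite eq_sym oner_eq0.
by have := hA a; rewrite !inE.
Qed.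

(** Weighted covering applies with weights [Q^n / M^n] and masses [M^n], since their products [Q^n]
    sum to 1. As [#|T n| <= #|A| ^ n], it costs a factor [2 * (1 + n * ln #|A|)], absorbed by
    [exp (n * delta)] for [n >= N]. *)
Lemma codebook {R : realType} {A : finType} (rho : A -> A -> R) (Q M : A -> R)
    (D r delta : R) (T : forall n : nat, {set {ffun 'I_n -> A}}) :
  is_pmf Q -> (forall a, 0 < M a) -> 0 < delta ->
  (forall n x, x \in T n -> 2^-1 * expR (- (n%:R * r)) <=
        \sum_(y : {ffun 'I_n -> A} | \sum_(i < n) rho (x i) (y i) <= n%:R * D)
           \prod_(i < n) (Q (y i) / M (y i))) ->
  exists (C : forall n : nat, {set {ffun 'I_n -> A}}) (N : nat),
    (forall n, (0 < n)%N -> ((n%:R^-1)%:E * elog (Mn M (C n)) <= (r + delta)%:E)%E) /\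
    (forall n x, (0 < n)%N -> (N <= n)%N -> x \in T n -> (rhonC rho x (C n) <= D%:E)%E).
Proof.
move=> [Q0 Q1] M0 d0 hT.
have A0 : (0 < #|A|)%N := pmf_card_gt0 Q (conj Q0 Q1).
have L0 : 0 <= ln #|A|%:R :> R by rewrite ln_ge0 // ler1n.
have [N hN] := polynomial_le_expR (ln #|A|%:R) delta L0 d0.
have cover n : exists C : {set {ffun 'I_n -> A}},
    ((N <= n)%N -> Mn M C <= expR (n%:R * (r + delta))) /\
    (forall x, x \in T n -> exists2 y, y \in C & \sum_(i < n) rho (x i) (y i) <= n%:R * D).
  pose p := 2^-1 * expR (- (n%:R * r)).
  have p0 : 0 < p by rewrite mulr_gt0 ?expR_gt0.
  have := @weighted_cover R _ _
    (fun x y : {ffun 'I_n -> A} => \sum_(i < n) rho (x i) (y i) <= n%:R * D)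
    (fun y => \prod_(i < n) (Q (y i) / M (y i))) (fun y => \prod_(i < n) M (y i)) p (T n).
  case=> [y|y||//|x /hT //|C hC cC].
  - by apply: prodr_ge0 => i _; rewrite divr_ge0 // ltW.
  - by apply: prodr_gt0.
  - under eq_bigr => y _ do rewrite -big_split /=.
    rewrite -(bigA_distr_bigA (fun _ a => Q a / M a * M a)) big1 // => i _.
    by rewrite -[RHS]Q1; apply: eq_bigr => a _; rewrite divfK // gt_eqF.
  exists C; split=> // Nn; apply: le_trans cC _.
  case: eqVneq => [_|Tn0]; first exact: expR_ge0.
  have -> : p^-1 = 2 * expR (n%:R * r) by rewrite /p invfM invrK expRN invrK.
  rewrite [n%:R * (r + _)]mulrDr expRD [2 * _]mulrC -mulrA ler_wpM2l ?expR_ge0 //.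
  apply: le_trans (hN n Nn); rewrite ler_pM2l // lerD2l.
  rewrite mulr_natl -lnXn ?ltr0n // ler_ln ?posrE ?exprn_gt0 ?ltr0n ?card_gt0 //.
  by rewrite -natrX ler_nat -[in leqRHS](card_ord n) -card_ffun max_card.
pose C0 n := sval (cid (cover n)); have hC0 n := svalP (cid (cover n)).
(* Below [N] the empty codebook has mass 0, hence [elog] equal to [-oo], and the rate bound holds;
   its distortion is [+oo], which is why the second claim asks for [N <= n]. *)
exists (fun n => if (N <= n)%N then C0 n else finset.set0), N; split.
  move=> n n0; have nR : 0 < n%:R^-1 :> R by rewrite invr_gt0 ltr0n.
  have : Mn M (if (N <= n)%N then C0 n else finset.set0) <= expR (n%:R * (r + delta)).
    case: ifP => [Nn|_]; last by rewrite /Mn big_set0 expR_ge0.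
    exact: (hC0 n).1.
  set m := Mn M _ => hm; rewrite /elog; case: eqVneq => [_|mn0].
    by rewrite gt0_muleNy ?lte_fin // leNye.
  have m0 : 0 < m.
    rewrite lt_neqAle eq_sym mn0; apply: sumr_ge0 => y _; apply: prodr_ge0 => i _.
    exact: ltW.
  rewrite -EFinM lee_fin ler_pdivrMl ?ltr0n // -[leRHS]expRK ler_ln ?posrE //.
  exact: expR_gt0.
move=> n x n0 Nn xT; rewrite Nn; have [y yC hy] := (hC0 n).2 x xT.
apply: le_trans (bigmin_le_cond _ _ yC) _.
by rewrite lee_fin /rhon ler_pdivrMl ?ltr0n.
Qed.

(** * Almost sure typicality *)

(** Borel-Cantelli: the probabilities of leaving [T n] are dominated by a geometric series. *)
Lemma eventually_typical {R : realType} {A : finType} (P : A -> R)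
    (T : forall n : nat, {set {ffun 'I_n -> A}}) (c q : R)
    (d : measure_display) (Omega : measurableType d)
    (Pr : probability Omega R) (X : nat -> Omega -> A) :
  is_pmf P -> 0 <= c -> 0 < q < 1 ->
  (forall n, \sum_(x | x \notin T n) \prod_(i < n) P (x i) <= c * q ^+ n) ->
  iid_with Pr X P ->
  {ae Pr, forall w, exists N : nat, forall n : nat, (N <= n)%N -> Xn X n w \in T n}.
Proof.
move=> /pmf_card_gt0 /card_gt0P[a0 _] c0 /andP[q0 q1] hT [mX hX].
(* Cylinders in the form evaluated by [iid_with]; [a0] only fills indices from [n] on, which the
   intersection never meets. *)
pose cyl n (x : {ffun 'I_n -> A}) : set Omega :=
  \bigcap_(i in [set` iota 0 n])
    (X i @^-1` [set (if insub i is Some j then x j else a0)]).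
have mcyl n x : measurable (cyl n x).
  by apply: bigcap_measurableType => // i _; exact: mX.
have cylE n x w : cyl n x w <-> Xn X n w = x.
  split=> [h|<- i /=].
    apply/ffunP => i; rewrite ffunE; have := h i; rewrite /= mem_iota ltn_ord.
    by move=> /(_ isT) ->; rewrite valK.
  rewrite mem_iota /= add0n => lt_in; rewrite insubT ffunE //.
have Pcyl n x : Pr (cyl n x) = (\prod_(i < n) P (x i))%:E.
  rewrite hX ?iota_uniq //; congr (_%:E).
  have -> : iota 0 n = index_iota 0 n by rewrite /index_iota subn0.
  rewrite big_mkord.
  by apply: eq_bigr => i _; rewrite valK.
pose F n : set Omega := \big[setU/set0]_(x | x \notin T n) cyl n x.
have mF n : measurable (F n) by apply: bigsetU_measurable.
have PF n : (Pr (F n) <= (c * q ^+ n)%:E)%E.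
  apply: le_trans (_ : (\sum_(x | x \notin T n) Pr (cyl n x) <= _)%E); last first.
    by under eq_bigr => x _ do rewrite Pcyl; rewrite sumEFin lee_fin.
  (* The union bound is proved by induction and needs measurability of the partial unions, so [K]
     carries both. *)
  pose K (U : set Omega) (u : \bar R) := measurable U /\ (Pr U <= u)%E.
  suff [] : K (F n) (\sum_(x | x \notin T n) Pr (cyl n x))%E by [].
  rewrite /F; elim/big_rec2: _ => [|x u U _ [mU hU]].
    by split; [exact: measurable0|rewrite measure0].
  split; first exact: measurableU.
  by apply: le_trans (measureU2 _ (mcyl n x) mU) _; rewrite leeD2l.
have Fsum : (\sum_(0 <= n <oo) Pr (F n) < +oo)%E.
  apply: le_lt_trans (lee_nneseries _ (fun n _ => PF n)) _ => //.
  apply: le_lt_trans (_ : ((c / (1 - q))%:E < _)%E); last exact: ltry.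
  apply: lime_le.
    by apply: is_cvg_nneseries => n _ _; rewrite lee_fin mulr_ge0 // exprn_ge0 // ltW.
  apply: nearW => n; rewrite sumEFin lee_fin; apply: geometric_le_lim => //.
  by rewrite gtr0_norm.
exists (lim_sup_set F); split.
- apply: bigcapT_measurable => k; apply: bigcup_measurable => i _; exact: mF.
- exact: lim_sup_set_cvg0.
- move=> w /= hw n _.
  apply: contrapT => hn; apply: hw; exists n => k nk; apply: contrapT => hk; apply: hn.
  exists k => //; rewrite /F (bigD1 (Xn X k w)) /=; last exact/negP.
  by left; apply/cylE.
Qed.

(** * Choice of the constants and conclusion *)

Theorem theorem2 (R : realType) (A : finType) (P : A -> R) (rho : A -> A -> R)
  (M : A -> R) :
  is_pmf P -> (forall a, 0 < P a) ->
  (forall x y, 0 <= rho x y) -> (forall x y, rho x y = 0 <-> x = y) ->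
  (forall a, 0 < M a) ->
  forall D eps : R, 0 <= D -> 0 < eps ->
  exists C : forall n : nat, {set {ffun 'I_n -> A}},
    (forall n : nat, (0 < n)%N ->
       ((n%:R^-1)%:E * elog (Mn M (C n)) <= Rfun rho P M D + eps%:E)%E) /\
    (forall (d : measure_display) (Omega : measurableType d)
            (Pr : probability Omega R) (X : nat -> Omega -> A),
       iid_with Pr X P ->
       {ae Pr, forall w, exists N : nat, forall n : nat, (N <= n)%N ->
          (rhonC rho (Xn X n w) (C n) <= D%:E)%E}).
Proof.
move=> hP P0 rho0 rhoE M0 D eps D0 eps0.
have rhoxx x : rho x x = 0 by apply/rhoE.
(* Budget: [eps / 2] for the coupling, [eps / 4] for the Chernoff slack and [eps / 4] for the
   covering factor. *)
have [Q [W [hQ hW hD hcost]]] := near_optimal_coupling rho P M D (eps / 2) hP P0 rho0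
  rhoxx D0 (divr_gt0 eps0 (ltr0n _ 2)).
set c := relent W _ + _ in hcost.
have e4 : 0 < eps / 4 by rewrite divr_gt0.
have hr : c < c + eps / 4 by rewrite ltrDl.
have [T [q [q01 hT1 hT2]]] := typical_sets rho P Q M W D (c + eps / 4) hP P0 hQ M0 D0 hW
  hD hr.
have [C [N [hC1 hC2]]] := codebook rho Q M D (c + eps / 4) (eps / 4) T hQ M0 e4 hT2.
exists C; split=> [n n0|d Omega Pr X hX].
  apply: le_trans (hC1 n n0) _.
  have -> : c + eps / 4 + eps / 4 = c + eps / 2 by field.
  rewrite EFinD; apply: le_trans (leeD2r _ hcost) _.
  by rewrite -addeA -EFinD -splitr.
apply: filterS (eventually_typical P T 4 q d Omega Pr X hP _ q01 hT1 hX) => // w [N' hN'].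
(* The 1 excludes length 0, where [hC2] gives nothing. *)
exists (maxn 1 (maxn N N')) => n; rewrite !geq_max => /and3P[n0 Nn N'n].
by apply: hC2 => //; exact: hN'.
Qed.
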